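(* Let $k\ge 0$ be an integer, let $0=t_0<t_1<\dots<t_N=T$ be a partition of $[0,T]$, and set $I_n:=(t_{n-1},t_n)$. Let $u_h^{\rm DG}$ be a discontinuous Galerkin approximation of degree $k$, with upwinding numerical trace $\widehat{u}_h^{\,\rm DG}$, to the solution of $\frac{d}{dt}u(t)=f(t,u(t))$ on $(0,T)$, $u(0)=u_0$, and let $u_h^{{\rm DG},*}$ be its elementwise post-processing, both as defined in the context. Then, for every $n=1,\dots,N$, $$\int_{I_n} v(t)\,\frac{d}{dt}u_h^{{\rm DG},*}(t)\,dt=\int_{I_n} f(t,u_h^{\rm DG}(t))\,v(t)\,dt\qquad\text{for all } v\in\mathcal{P}_k(I_n),$$ $$u_h^{{\rm DG},*}(t_{n-1}^+)=u_h^{{\rm DG},*}(t_{n-1}^-),$$ where $u_h^{{\rm DG},*}(0^-):=u_0$.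
   Context: For an integer $m\ge 0$, $\mathcal{P}_m(I_n)$ is the space of real polynomials of degree at most $m$ on $I_n$. For a piecewise polynomial $w$, $w(t_m^{\pm})$ denote the one-sided limits at $t_m$. The function $f$ is real-valued on $[0,T]\times\mathbb{R}$, $u_0\in\mathbb{R}$, and the integrals involving $f$ below are assumed to be well defined. DG method of degree $k$. The function $u_h^{\rm DG}$ satisfies $u_h^{\rm DG}|_{I_n}\in\mathcal{P}_k(I_n)$ for $n=1,\dots,N$. Set $u_h^{\rm DG}(0^-):=u_0$ and define the upwinding numerical trace, at the nodes only, by $\widehat{u}_h^{\,\rm DG}(t_m):=u_h^{\rm DG}(t_m^-)$ for $m=0,\dots,N$; by convention $\widehat{u}_h^{\,\rm DG}(t_m^{\pm}):=\widehat{u}_h^{\,\rm DG}(t_m)$. For each $n=1,\dots,N$, $u_h^{\rm DG}$ satisfies, for all $v\in\mathcal{P}_k(I_n)$, $$-\int_{I_n}u_h^{\rm DG}(t)\,\frac{d}{dt}v(t)\,dt+\widehat{u}_h^{\,\rm DG}(t_n)\,v(t_n^-)-\widehat{u}_h^{\,\rm DG}(t_{n-1})\,v(t_{n-1}^+)=\int_{I_n}f(t,u_h^{\rm DG}(t))\,v(t)\,dt.$$ Scaled left-Radau polynomial. With $P_\ell$ the Legendre polynomial of degree $\ell$ on $[-1,1]$ (normalized by $P_\ell(1)=1$), let $R_{k+1}(\tau):=\tfrac12P_{k+1}(-1)P_{k+1}(\tau)+\tfrac12P_k(-1)P_k(\tau)$ and $\mathcal{R}_{n,k+1}(t):=R_{k+1}(\tau_n(t))$,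 where $\tau_n(t):=(2t-(t_n+t_{n-1}))/(t_n-t_{n-1})$. Post-processing. For $t\in I_n$, $n=1,\dots,N$, $$u_h^{{\rm DG},*}(t):=u_h^{\rm DG}(t)+\big(\widehat{u}_h^{\,\rm DG}(t_{n-1})-u_h^{\rm DG}(t_{n-1}^+)\big)\,\mathcal{R}_{n,k+1}(t).$$ *)

(* Defs.v *)
From HB Require Import structures.
From mathcomp Require Import all_boot all_order all_algebra.
From mathcomp Require Import all_classical all_reals all_analysis.
Set Implicit Arguments.
Unset Strict Implicit.
Unset Printing Implicit Defensive.
Import Order.TTheory GRing.Theory Num.Theory.
Import numFieldNormedType.Exports.
Local Open Scope classical_set_scope.
Local Open Scope ring_scope.

(* Rodrigues' formula; see [legendre1] for the normalization. *)
Definition legendre (R : realType) (l : nat) : {poly R} :=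
  ((2 ^+ l * l`!%:R)^-1) *: (('X^2 - 1) ^+ l)^`(l).

Lemma horner_derivn_expXsubC1 (R : realType) (l : nat) (q : {poly R}) :
  (('X - 1) ^+ l * q)^`(l).[1] = l`!%:R * q.[1].
Proof.
elim: l q => [|l IHl] q; first by rewrite expr0 mul1r derivn0 fact0 mul1r.
rewrite derivSn.
have -> : (('X - 1) ^+ l.+1 * q)^`() =
    ('X - 1) ^+ l * (q *+ l.+1 + ('X - 1) * q^`()).
  rewrite derivM deriv_exp derivB derivX derivC subr0 mul1r /= mulrDr.
  by rewrite mulrnAl mulrnAr mulrA -exprSr.
rewrite IHl hornerD hornerMn hornerM !hornerE subrr mul0r addr0 factS natrM.
by rewrite -[_ *+ l.+1]mulr_natl mulrA [_ * l.+1%:R]mulrC.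
Qed.

Lemma legendre1 (R : realType) (l : nat) : (legendre R l).[1] = 1.
Proof.
have e : 'X^2 - 1 = ('X - 1) * ('X + 1) :> {poly R}.
  by rewrite -subr_sqr expr1n.
rewrite /legendre hornerZ.
rewrite e exprMn horner_derivn_expXsubC1 horner_exp hornerD hornerX hornerC.
by rewrite -[1 + 1]/(2%:R) [l`!%:R * _]mulrC mulVf // mulf_neq0.
Qed.

(* R_{k+1}, with k as the argument. *)
Definition left_radau (R : realType) (k : nat) : {poly R} :=
  ((legendre R k.+1).[-1] / 2) *: legendre R k.+1
  + ((legendre R k).[-1] / 2) *: legendre R k.

(* The values of the mesh function t beyond index N are irrelevant. *)
Definition is_partition (R : realType) (T : R) (N : nat) (t : nat -> R) : Prop :=
  [/\ (0 < N)%N, t 0%N = 0, t N = T &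
      forall n : nat, (1 <= n <= N)%N -> t n.-1 < t n].

Definition cell (R : realType) (t : nat -> R) (n : nat) : set R :=
  `]t n.-1, t n[%classic.

(* w restricted to I is a polynomial of degree at most m; functions on the
   mesh are total, but their values at the nodes never matter. *)
Definition poly_on (R : realType) (m : nat) (I : set R) (w : R -> R) : Prop :=
  exists2 p : {poly R}, (size p <= m.+1)%N & forall x, I x -> w x = p.[x].

Definition left_lim (R : realType) (w : R -> R) (a : R) : R :=
  lim (w x @[x --> a^'-]).

Definition right_lim (R : realType) (w : R -> R) (a : R) : R :=
  lim (w x @[x --> a^'+]).

(* w(t_m^-), with the convention w(0^-) := u0. *)
Definition node_left_lim (R : realType) (u0 : R) (t : nat -> R) (w : R -> R)
    (m : nat) : R :=
  if m == 0%N then u0 else left_lim w (t m).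

Definition upwind_trace (R : realType) (u0 : R) (t : nat -> R) (u : R -> R)
    (m : nat) : R :=
  node_left_lim u0 t u m.

Definition rhs_integrable (R : realType) (k N : nat) (t : nat -> R)
    (f : R -> R -> R) (u : R -> R) : Prop :=
  forall n : nat, (1 <= n <= N)%N ->
  forall v : R -> R, poly_on k (cell t n) v ->
    (@lebesgue_measure R).-integrable (cell t n)
      (fun x => (f x (u x) * v x)%:E).

Definition is_DG (R : realType) (k N : nat) (t : nat -> R)
    (f : R -> R -> R) (u0 : R) (u : R -> R) : Prop :=
  forall n : nat, (1 <= n <= N)%N ->
    poly_on k (cell t n) u /\
    forall v : R -> R, poly_on k (cell t n) v ->
      - (\int[@lebesgue_measure R]_(x in cell t n) (u x * derive1 v x))
      + upwind_trace u0 t u n * left_lim v (t n)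
      - upwind_trace u0 t u n.-1 * right_lim v (t n.-1)
      = \int[@lebesgue_measure R]_(x in cell t n) (f x (u x) * v x).

Definition cell_map (R : realType) (t : nat -> R) (n : nat) (x : R) : R :=
  (2 * x - (t n + t n.-1)) / (t n - t n.-1).

Definition scaled_radau (R : realType) (t : nat -> R) (n k : nat) (x : R) : R :=
  (left_radau R k).[cell_map t n x].

Definition is_postprocessing (R : realType) (k N : nat) (t : nat -> R)
    (u0 : R) (u us : R -> R) : Prop :=
  forall n : nat, (1 <= n <= N)%N -> forall x : R, cell t n x ->
    us x = u x + (upwind_trace u0 t u n.-1 - right_lim u (t n.-1))
                 * scaled_radau t n k x.

(* Main.v *)
(* On each cell the post-processed function is the polynomial p + c R, where p
   is the DG polynomial, c the jump at the left node and R the scaled Radau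
   polynomial.  Since R is 1 at the left end, 0 at the right end and orthogonal
   to polynomials of degree less than k, integrating v R' by parts gives
   - v(t_{n-1}^+): the correction c R contributes exactly the jump term of the
   DG equation. *)
Require Import Defs.
From HB Require Import structures.
From mathcomp Require Import all_boot all_order all_algebra.
From mathcomp Require Import all_classical all_reals all_analysis.
From mathcomp Require Import measurable_realfun ring zify.
Import Order.TTheory GRing.Theory Num.Theory.
Import numFieldNormedType.Exports.
Local Open Scope classical_set_scope.
Local Open Scope ring_scope.

(** * Endpoint values of Legendre and Radau polynomials *)

(** Each differentiation lowers the multiplicity of the root [a] by one and multiplies the
    cofactor's value at [a] by the current exponent; these exponents build up the falling
    factorial. *)
Lemma derivn_expXsubC (R : realType) (a : R) (l j : nat) (q : {poly R}) :
  (j <= l)%N ->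
  exists2 r : {poly R},
    (('X - a%:P) ^+ l * q)^`(j) = ('X - a%:P) ^+ (l - j) * r &
    r.[a] = (l ^_ j)%:R * q.[a].
Proof.
elim: j => [_|j IHj jl].
  by exists q; rewrite ?subn0 // ffactn0 mul1r.
have [r er ra] := IHj (ltnW jl).
exists (r *+ (l - j) + ('X - a%:P) * r^`()).
  rewrite derivnS er derivM deriv_exp derivB derivX derivC subr0 mul1r.
  have -> : (l - j = (l - j.+1).+1)%N by lia.
  by rewrite /= exprSr; ring.
rewrite hornerD hornerMn hornerM ra !hornerE subrr
  mul0r addr0 ffactnSr natrM -mulr_natr.
by ring.
Qed.

Lemma polyX2sub1 (R : realType) :
  'X^2 - 1 = ('X - 1%:P) * ('X - (-1)%:P) :> {poly R}.
Proof. by rewrite polyCN polyC1; ring. Qed.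

(** The hypothesis on [s] covers both endpoints at once: each is a root of multiplicity [l], hence
    survives fewer than [l] differentiations. *)
Lemma rodrigues_vanish (R : realType) (l j : nat) (s : R) :
  s ^+ 2 = 1 -> (j < l)%N -> ((('X^2 - 1 : {poly R}) ^+ l)^`(j)).[s] = 0.
Proof.
move=> s2 jl.
have -> : 'X^2 - 1 = ('X - s%:P) * ('X + s%:P) :> {poly R}.
  by rewrite -subr_sqr -polyC_exp s2.
rewrite exprMn.
have [r -> _] := derivn_expXsubC _ s _ _ (('X + s%:P) ^+ l) (ltnW jl).
by rewrite !hornerE subrr expr0n subn_eq0 leqNgt jl mul0r.
Qed.

Lemma legendreN1 (R : realType) (l : nat) : (legendre R l).[-1] = (-1) ^+ l.
Proof.
(* The power of X + 1 goes in front: after [l] derivatives its cofactor has value l! (-2)^l at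
   -1. *)
rewrite /legendre hornerZ polyX2sub1 exprMn mulrC [_ ^+ l * _]mulrC.
have [r er ra] := derivn_expXsubC R (-1) l l (('X - 1%:P) ^+ l) (leqnn l).
rewrite er subnn expr0 mul1r ra; rewrite ffactnn !hornerE.
have -> : -1 - 1 = -1 * 2 :> R by ring.
by rewrite exprMn; field; rewrite !pnatr_eq0 -lt0n fact_gt0 expf_neq0.
Qed.

Lemma left_radau1 (R : realType) (k : nat) : (left_radau R k).[1] = 0.
Proof.
by rewrite /left_radau hornerD 2!hornerZ !legendre1 !legendreN1 exprS; field.
Qed.

Lemma left_radauN1 (R : realType) (k : nat) : (left_radau R k).[-1] = 1.
Proof.
rewrite /left_radau hornerD 2!hornerZ !legendreN1 exprS.
have e : (-1) ^+ k * (-1) ^+ k = 1 :> R by rewrite -exprMn mulrNN mulr1 expr1n.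
by rewrite -[RHS]e; field.
Qed.

(** * Orthogonality to polynomials of lower degree *)

(* Repeated integration by parts in Rodrigues' formula. *)
Lemma rodrigues_primitive (R : realType) (l j : nat) (q : {poly R}) :
  (j <= l)%N -> (size q <= j)%N ->
  exists Q : {poly R},
    [/\ Q^`() = q * (('X^2 - 1) ^+ l)^`(j), Q.[1] = 0 & Q.[-1] = 0].
Proof.
elim: j q => [|j IHj] q jl sq.
  exists 0; rewrite !horner0 deriv0; split => //.
  by move: sq; rewrite leqn0 size_poly_eq0 => /eqP ->; rewrite mul0r.
have sq' : (size q^`() <= j)%N.
  have [->|q0] := eqVneq q 0; first by rewrite deriv0 size_poly0.
  by have := lt_size_deriv q0; lia.
have [Q [dQ Q1 QN1]] := IHj _ (ltnW jl) sq'.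
(* With G = (X^2 - 1)^l, q G^(j+1) = (q G^(j))' - q' G^(j). The induction hypothesis integrates the
   last term, and G^(j) vanishes at both ends because j < l. *)
exists (q * (('X^2 - 1) ^+ l)^`(j) - Q); split.
- by rewrite derivB derivM dQ -derivnS; ring.
- by rewrite !hornerE Q1 rodrigues_vanish // ?expr1n // mulr0 subr0.
- by rewrite !hornerE QN1 rodrigues_vanish // ?sqrrN ?expr1n // mulr0 subr0.
Qed.

(** Orthogonality is phrased through a primitive vanishing at both ends, so that it stays purely
    algebraic and transfers to a cell by composition. *)
Lemma legendre_primitive (R : realType) (l : nat) (q : {poly R}) :
  (size q <= l)%N ->
  exists Q : {poly R}, [/\ Q^`() = q * legendre R l, Q.[1] = 0 & Q.[-1] = 0].
Proof.
move=> sq; have [Q [dQ Q1 QN1]] := rodrigues_primitive _ _ _ _ (leqnn l) sq.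
exists ((2 ^+ l * l`!%:R)^-1 *: Q); split.
- by rewrite derivZ dQ /legendre -scalerAr.
- by rewrite hornerZ Q1 mulr0.
- by rewrite hornerZ QN1 mulr0.
Qed.

Lemma left_radau_primitive (R : realType) (k : nat) (q : {poly R}) :
  (size q <= k)%N ->
  exists Q : {poly R},
    [/\ Q^`() = q * left_radau R k, Q.[1] = 0 & Q.[-1] = 0].
Proof.
move=> sq.
have [A [dA A1 AN1]] := legendre_primitive _ _ _ (leqW sq).
have [B [dB B1 BN1]] := legendre_primitive _ _ _ sq.
exists (((legendre R k.+1).[-1] / 2) *: A + ((legendre R k).[-1] / 2) *: B).
split.
- by rewrite derivD !derivZ dA dB mulrDr -!scalerAr.
- by rewrite !hornerE A1 B1 !mulr0 addr0.
- by rewrite !hornerE AN1 BN1 !mulr0 addr0.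
Qed.

(** * Integrals, one-sided limits and derivatives of polynomials *)

Lemma poly_primitive (R : realType) (p : {poly R}) : exists P, P^`() = p.
Proof.
(* At i = 0 the coefficient is a division by zero, hence 0; differentiation discards it. *)
exists (\poly_(i < (size p).+1) (p`_i.-1 / i%:R)).
apply/polyP => i; rewrite coef_deriv coef_poly ltnS.
case: ltnP => [_|/leq_sizeP ->] //; last by rewrite mul0rn.
by rewrite /= -[LHS]mulr_natr mulfVK // pnatr_eq0.
Qed.

Lemma Rintegral_deriv_poly (R : realType) (a b : R) (P : {poly R}) : a < b ->
  \int[@lebesgue_measure R]_(x in `]a, b[) P^`().[x] = P.[b] - P.[a].
Proof.
(* The endpoints are added to the domain, a null set, since the fundamental theorem of calculus is
   applied on the closed interval. *)
move=> ab; rewrite /Rintegral -(integral_itv_bndoo true false); last first.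
  apply/measurable_EFinP; apply: measurable_funTS.
  by apply: continuous_measurable_fun; exact: continuous_horner.
rewrite (@continuous_FTC2 _ _ (horner P)) //.
- by apply: continuous_subspaceT; exact: continuous_horner.
- split => [x _||]; first exact: derivable_horner.
  + by apply: cvg_at_right_filter; exact: continuous_horner.
  + by apply: cvg_at_left_filter; exact: continuous_horner.
- by move=> x _; rewrite derivE.
Qed.

Lemma right_lim_poly (R : realType) (w : R -> R) (p : {poly R}) (a b : R) :
  a < b -> (forall x, `]a, b[%classic x -> w x = p.[x]) ->
  right_lim w a = p.[a].
Proof.
move=> ab wp; apply: cvg_lim => //.
have /near_eq_cvg : \forall x \near a^'+, p.[x] = w x.
  near=> x; apply/esym/wp; rewrite /= in_itv /=; apply/andP; split; near: x.
    exact: nbhs_right_gt.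
  exact: nbhs_right_lt.
move=> /cvg_trans; apply.
by apply: cvg_at_right_filter; exact: continuous_horner.
Unshelve. all: by end_near. Qed.

Lemma left_lim_poly (R : realType) (w : R -> R) (p : {poly R}) (a b : R) :
  a < b -> (forall x, `]a, b[%classic x -> w x = p.[x]) ->
  left_lim w b = p.[b].
Proof.
move=> ab wp; apply: cvg_lim => //.
have /near_eq_cvg : \forall x \near b^'-, p.[x] = w x.
  near=> x; apply/esym/wp; rewrite /= in_itv /=; apply/andP; split; near: x.
    exact: nbhs_left_gt.
  exact: nbhs_left_lt.
move=> /cvg_trans; apply.
by apply: cvg_at_left_filter; exact: continuous_horner.
Unshelve. all: by end_near. Qed.

Lemma derive1_poly (R : realType) (w : R -> R) (p : {poly R}) (a b x : R) :
  (forall y, `]a, b[%classic y -> w y = p.[y]) -> `]a, b[%classic x ->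
  derive1 w x = p^`().[x].
Proof.
move=> wp abx; rewrite derivE !derive1E; apply: near_eq_derive.
near=> y; apply: wp; near: y.
by apply: open_nbhs_nbhs; split => //; exact: interval_open.
Unshelve. all: by end_near. Qed.

(** * The Radau polynomial on a cell *)

(** This is [cell_map] as a polynomial, which makes the scaled Radau polynomial a formal
    composition. *)
Definition reference_map (R : realType) (a b : R) : {poly R} :=
  (2 / (b - a)) *: 'X - ((b + a) / (b - a))%:P.

Lemma horner_reference_map (R : realType) (a b x : R) :
  (reference_map R a b).[x] = (2 * x - (b + a)) / (b - a).
Proof. by rewrite !hornerE mulrBl mulrAC. Qed.

Definition radau_on (R : realType) (k : nat) (a b : R) : {poly R} :=
  left_radau R k \Po reference_map R a b.

Lemma horner_radau_on (R : realType) (k : nat) (a b x : R) :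
  (radau_on R k a b).[x] = (left_radau R k).[(2 * x - (b + a)) / (b - a)].
Proof. by rewrite horner_comp horner_reference_map. Qed.

Lemma radau_on_left (R : realType) (k : nat) (a b : R) :
  a < b -> (radau_on R k a b).[a] = 1.
Proof.
move=> ab; rewrite horner_radau_on -[RHS](left_radauN1 R k).
by congr _.[_]; field; rewrite subr_eq0 gt_eqF.
Qed.

Lemma radau_on_right (R : realType) (k : nat) (a b : R) :
  a < b -> (radau_on R k a b).[b] = 0.
Proof.
move=> ab; rewrite horner_radau_on -[RHS](left_radau1 R k).
by congr _.[_]; field; rewrite subr_eq0 gt_eqF.
Qed.

(** Pulling [q] back to [-1, 1] reduces this to [left_radau_primitive]. Equal end values suffice, as
    they make the integral of the derivative zero. *)
Lemma radau_on_primitive (R : realType) (k : nat) (a b : R) (q : {poly R}) :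
  a < b -> (size q <= k)%N ->
  exists Q : {poly R}, Q^`() = q * radau_on R k a b /\ Q.[a] = Q.[b].
Proof.
move=> ab sq; have d0 : b - a != 0 by rewrite subr_eq0 gt_eqF.
pose tau := reference_map R a b.
(* The inverse of [tau]; being of degree one, it preserves the size of [q] under composition. *)
pose sigma : {poly R} := ((b - a) / 2) *: 'X + ((b + a) / 2)%:P.
have sigmaK : sigma \Po tau = 'X.
  rewrite comp_polyD comp_polyZ comp_polyX comp_polyC /tau /reference_map.
  rewrite -!mul_polyC mulrBr mulrA -!polyCM.
  have -> : (b - a) / 2 * (2 / (b - a)) = 1 by field.
  have -> : (b - a) / 2 * ((b + a) / (b - a)) = (b + a) / 2 by field.
  by rewrite polyC1 mul1r subrK.
have ssig : (size (q \Po sigma) <= k)%N.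
  apply: leq_trans sq; rewrite size_comp_poly2 //.
  have c0 : (b - a) / 2 != 0 by rewrite mulf_neq0.
  by rewrite size_polyDl ?size_scale ?size_polyX // ltnS size_polyC_leq1.
have [Q [dQ Q1 QN1]] := left_radau_primitive _ _ _ ssig.
(* The factor (b - a) / 2 cancels the derivative of [tau]. *)
exists (((b - a) / 2) *: (Q \Po tau)); split.
  rewrite derivZ deriv_comp dQ comp_polyM -comp_polyA sigmaK comp_polyXr.
  rewrite derivB derivZ derivX derivC subr0 -scalerAr mulr1 scalerA.
  have -> : (b - a) / 2 * (2 / (b - a)) = 1 by field.
  by rewrite scale1r.
rewrite !hornerZ !horner_comp !horner_reference_map.
have -> : (2 * a - (b + a)) / (b - a) = -1 by field.
have -> : (2 * b - (b + a)) / (b - a) = 1 by field.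
by rewrite Q1 QN1.
Qed.

(** * Integration by parts and the correction term *)

Lemma Rintegral_by_parts_poly (R : realType) (a b : R) (v p : {poly R}) :
  a < b ->
  \int[@lebesgue_measure R]_(x in `]a, b[) (v * p^`()).[x] =
  v.[b] * p.[b] - v.[a] * p.[a]
  - \int[@lebesgue_measure R]_(x in `]a, b[) (p * v^`()).[x].
Proof.
move=> ab; have [A dA] := poly_primitive _ (p * v^`()).
have -> : v * p^`() = (v * p - A)^`() by rewrite derivB derivM dA; ring.
by rewrite -dA !Rintegral_deriv_poly // !hornerE; ring.
Qed.

Lemma Rintegral_radau_correction (R : realType) (k : nat) (a b c : R)
    (v p : {poly R}) : a < b -> (size v <= k.+1)%N ->
  \int[@lebesgue_measure R]_(x in `]a, b[)
    (v * (p + c *: radau_on R k a b)^`()).[x] =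
  v.[b] * p.[b] - v.[a] * p.[a]
  - \int[@lebesgue_measure R]_(x in `]a, b[) (p * v^`()).[x] - c * v.[a].
Proof.
move=> ab sv; rewrite Rintegral_by_parts_poly //.
have sv' : (size v^`() <= k)%N.
  have [->|v0] := eqVneq v 0; first by rewrite deriv0 size_poly0.
  by have := lt_size_deriv v0; lia.
have [S [dS Sab]] := radau_on_primitive _ _ _ _ _ ab sv'.
have [A dA] := poly_primitive _ (p * v^`()).
(* The part [c *: S] has equal values at [a] and [b], so it drops out of the integral. *)
have -> : (p + c *: radau_on R k a b) * v^`() = (A + c *: S)^`().
  by rewrite derivD derivZ dA dS -!mul_polyC; ring.
rewrite -dA !Rintegral_deriv_poly // !hornerE radau_on_left //.
by rewrite radau_on_right // Sab; ring.
Qed.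

Lemma postprocessing_poly (R : realType) (k N : nat) (t : nat -> R) (u0 : R)
    (u us : R -> R) (n : nat) (p : {poly R}) :
  t n.-1 < t n -> is_postprocessing k N t u0 u us -> (1 <= n <= N)%N ->
  (forall x, cell t n x -> u x = p.[x]) ->
  forall x, cell t n x -> us x = (p +
    (upwind_trace u0 t u n.-1 - p.[t n.-1]) *: radau_on R k (t n.-1) (t n)).[x].
Proof.
move=> ab us_post nN up x xn; rewrite (us_post _ nN _ xn) up //.
rewrite (right_lim_poly _ _ _ _ _ ab up) hornerD hornerZ; congr (_ + _ * _).
by rewrite horner_radau_on.
Qed.

Theorem theorem3p1 (R : realType) (k N : nat) (T : R) (t : nat -> R)
    (f : R -> R -> R) (u0 : R) (u us : R -> R)
    (t_partition : is_partition T N t)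
    (f_integrable : rhs_integrable k N t f u)
    (u_DG : is_DG k N t f u0 u)
    (us_post : is_postprocessing k N t u0 u us) :
  forall n : nat, (1 <= n <= N)%N ->
    (forall v : R -> R, poly_on k (cell t n) v ->
       \int[@lebesgue_measure R]_(x in cell t n) (v x * derive1 us x)
       = \int[@lebesgue_measure R]_(x in cell t n) (f x (u x) * v x)) /\
    right_lim us (t n.-1) = node_left_lim u0 t us n.-1.
Proof.
have [_ _ _ t_incr] := t_partition.
move=> n nN; have ab := t_incr _ nN.
have [[p sp up] DG] := u_DG _ nN.
have usq := postprocessing_poly _ _ _ _ _ _ _ _ _ ab us_post nN up.
split=> [v v_poly|].
  rewrite -(DG _ v_poly); have [r sr vr] := v_poly.
  rewrite (left_lim_poly _ _ _ _ _ ab vr) (right_lim_poly _ _ _ _ _ ab vr).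
  (* Since n >= 1, the trace at [t n] is a genuine left limit. The trace at [t n.-1] stays folded,
     to match the one in the jump. *)
  rewrite {1}/upwind_trace /node_left_lim ifF; last by lia.
  rewrite (left_lim_poly _ _ _ _ _ ab up).
  under eq_Rintegral => x xn.
    rewrite vr ?(derive1_poly _ _ _ _ _ _ usq) -?hornerM; try exact: set_mem.
    over.
  rewrite Rintegral_radau_correction //.
  under [in RHS]eq_Rintegral => x xn.
    rewrite up ?(derive1_poly _ _ _ _ _ _ vr) -?hornerM; try exact: set_mem.
    over.
  (* The term p v at the left node cancels against the same term in the jump times v, leaving the
     upwind trace times v. *)
  by rewrite /=; ring.
(* At the left node the Radau factor is 1, so p plus the jump equals the upwind trace there. *)
rewrite (right_lim_poly _ _ _ _ _ ab usq).
rewrite !hornerE radau_on_left // mulr1 addrC subrK.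
(* On the first cell both sides are [u0]. Otherwise the Radau factor of the preceding cell vanishes
   at its right end, so [us] and [u] have the same left limit. *)
rewrite /upwind_trace /node_left_lim; case: ifP => // n1.
have n1N : (1 <= n.-1 <= N)%N by lia.
have ab1 := t_incr _ n1N; have [[p1 _ up1] _] := u_DG _ n1N.
have usq1 := postprocessing_poly _ _ _ _ _ _ _ _ _ ab1 us_post n1N up1.
rewrite (left_lim_poly _ _ _ _ _ ab1 usq1) (left_lim_poly _ _ _ _ _ ab1 up1).
by rewrite !hornerE radau_on_right // mulr0 addr0.
Qed.
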